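(* Let $R$ be a finite chain ring, let $0<k<n$ be integers, and let $a(x)=a_kx^k+a_0$ and $b(x)=b_kx^k+b_0$ be two binomials in $B_k$ (so $a_k,a_0,b_k,b_0\in R^\times$). The following are equivalent: (i) $a(x)\sim_n b(x)$, i.e. $a(x)$ and $b(x)$ are $n$-equivalent; (ii) there exists $\alpha\in R^\times$ such that $b_k\alpha^{n-k}-a_k=b_0\alpha^n-a_0=0$; (iii) $a(x)\star b(x)^{-1}\in H_k=\{\alpha^{n-k}x^k+\alpha^n \mid \alpha\in R^\times\}$.
   Context: A finite chain ring $R$ is a finite commutative local ring with identity whose ideals are linearly ordered by inclusion; $R^\times$ is its group of units. For $0<k<n$, $B_k=\{b_1x^k+b_0 \mid b_1,b_0\in R^\times\}\subset R[x]$, and $\star$ is the coefficientwise product on $B_k$: $(a_1x^k+a_0)\star(b_1x^k+b_0)=a_1b_1x^k+a_0b_0$. $(B_k,\star)$ is an abelian group, and $b(x)^{-1}$ denotes the inverse with respect to $\star$, i.e. $(b_1x^k+b_0)^{-1}=b_1^{-1}x^k+b_0^{-1}$. Let $B=\bigsqcup_{0<k<n}B_k$. Two elements $a(x),b(x)\in B$ are $n$-equivalent, written $a(x)\sim_n b(x)$, if there exists $\alpha\in R^\times$ such that $f(x)\mapsto f(\alpha x)$ is a (well-defined) $R$-algebra isomorphism $R[x]/\langle x^n-a(x)\rangle\to R[x]/\langle x^n-b(x)\rangle$. *)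

(* Defs.v *)
From HB Require Import structures.
From mathcomp Require Import all_boot all_order all_algebra.

Set Implicit Arguments.
Unset Strict Implicit.
Unset Printing Implicit Defensive.

Import GRing.Theory.
Local Open Scope ring_scope.

Section ChainRing.

Variable R : finComUnitRingType.
Implicit Types I J M : {set R}.

(* Ideals of R are the R-submodules of the regular module R^o. *)
Definition is_ideal I : Prop := submod_closed (mem I : {pred R^o}).

Definition is_maximal_ideal M : Prop :=
  [/\ is_ideal M, M != [set: R]
    & forall J, is_ideal J -> M \subset J -> J = M \/ J = [set: R]].

Definition is_local : Prop := exists! M : {set R}, is_maximal_ideal M.

Definition finite_chain_ring : Prop :=
  is_local /\
  (forall I J, is_ideal I -> is_ideal J -> I \subset J \/ J \subset I).

End ChainRing.

Section Binomials.

Variable R : finComUnitRingType.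
Implicit Types (k n : nat) (a b f : {poly R}).

Definition binom k (b1 b0 : R) : {poly R} := b1 *: 'X^k + b0%:P.

Definition B k b : Prop :=
  exists b1 b0 : R,
    [/\ b1 \is a GRing.unit, b0 \is a GRing.unit & b = binom k b1 b0].

Definition star k a b : {poly R} := binom k (a`_k * b`_k) (a`_0 * b`_0).

Definition star_one k : {poly R} := binom k 1 1.

Definition star_inv k b : {poly R} := binom k (b`_k)^-1 (b`_0)^-1.

Definition H n k f : Prop :=
  exists2 alpha : R, alpha \is a GRing.unit
                   & f = binom k (alpha ^+ (n - k)) (alpha ^+ n).

(* {poly %/ h} is R[x]/<h> when h is monic of positive degree, which holds for
   h = x^n - a(x) with a in B_k and 0 < k < n (lemma mk_monic_subXn below).
   The map f(x) |-> f(alpha x) is well defined on the quotients and is an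
   isomorphism of R-algebras iff it is induced by some bijective phi. *)
Definition nequiv n a b : Prop :=
  exists2 alpha : R, alpha \is a GRing.unit &
  exists phi : {lrmorphism {poly %/ 'X^n - a} -> {poly %/ 'X^n - b}},
    bijective phi /\
    (forall f : {poly R},
       phi (in_qpoly ('X^n - a) f) = in_qpoly ('X^n - b) (f \Po (alpha *: 'X))).

Lemma coef_binomk k (b1 b0 : R) : (0 < k)%N -> (binom k b1 b0)`_k = b1.
Proof.
by case: k => // k _; rewrite coefD coefZ coefXn coefC eqxx mulr1 addr0.
Qed.

Lemma coef_binom0 k (b1 b0 : R) : (0 < k)%N -> (binom k b1 b0)`_0 = b0.
Proof. by case: k => // k _; rewrite coefD coefZ coefXn coefC mulr0 add0r. Qed.

Lemma B_star k a b : (0 < k)%N -> B k a -> B k b -> B k (star k a b).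
Proof.
move=> k0 [a1 [a0 [ua1 ua0 ->]]] [b1 [b0 [ub1 ub0 ->]]].
exists (a1 * b1), (a0 * b0); split; rewrite ?unitrM ?ua1 ?ua0 //.
by rewrite /star !coef_binomk ?coef_binom0.
Qed.

Lemma B_star_inv k b : (0 < k)%N -> B k b -> B k (star_inv k b).
Proof.
move=> k0 [b1 [b0 [ub1 ub0 ->]]]; exists b1^-1, b0^-1.
by split; rewrite ?unitrV // /star_inv coef_binomk ?coef_binom0.
Qed.

Lemma star_binomV k b :
  (0 < k)%N -> B k b -> star k b (star_inv k b) = star_one k.
Proof.
move=> k0 [b1 [b0 [ub1 ub0 ->]]].
by rewrite /star /star_inv !coef_binomk ?coef_binom0 // !divrr.
Qed.

Lemma star_1binom k b : (0 < k)%N -> B k b -> star k (star_one k) b = b.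
Proof.
move=> k0 [b1 [b0 [_ _ ->]]].
by rewrite /star /star_one !coef_binomk ?coef_binom0 // !mul1r.
Qed.

Lemma mk_monic_subXn n k b :
  (0 < k < n)%N -> B k b -> mk_monic ('X^n - b) = 'X^n - b.
Proof.
move=> /andP[k0 kn] [b1 [b0 [_ _ ->]]]; set c := binom k b1 b0.
have sc : (size (- c) < size ('X^n : {poly R}))%N.
  rewrite size_polyN size_polyXn ltnS (leq_trans (size_polyD _ _)) // geq_max.
  rewrite (leq_trans (size_scale_leq _ _)) ?size_polyXn //=.
  by rewrite (leq_trans (size_polyC_leq1 _)) // (leq_ltn_trans _ kn).
rewrite /mk_monic size_polyDl // size_polyXn ltnS (ltn_trans k0 kn) /=.
by rewrite monicE lead_coefDl // lead_coefXn eqxx.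
Qed.

End Binomials.

(* Main.v *)
(** The substitution f(x) |-> f(alpha x) descends to the quotients iff
    x^n - b(x) divides (alpha x)^n - a(alpha x). Modulo x^n - b(x) the latter is
    alpha^n b(x) - a(alpha x), a binomial of degree < n, so it must vanish: this
    is (ii). Condition (ii) is preserved by exchanging a and b and inverting
    alpha, so the substitution x |-> alpha^-1 x descends too and is inverse to
    the first one. *)
Require Import Defs.
From HB Require Import structures.
From mathcomp Require Import all_boot all_order all_algebra.
From mathcomp Require Import ring.

Set Implicit Arguments.
Unset Strict Implicit.
Unset Printing Implicit Defensive.

Import GRing.Theory.
Local Open Scope ring_scope.

Section QuotientSubstitution.

Variable R : comNzRingType.
Implicit Types f g h q : {poly R}.

Lemma qpoly_divE h f :
  f = Pdiv.CommonRing.rdivp f (mk_monic h) * mk_monic h + in_qpoly h f.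
Proof. exact: Pdiv.RingMonic.rdivp_eq (monic_mk_monic h) f. Qed.

Lemma in_qpoly_modulus h : mk_monic h = h -> in_qpoly h h = 0.
Proof.
move=> hE; apply: val_inj; rewrite /= -[X in Pdiv.CommonRing.rmodp X]hE.
by rewrite Pdiv.RingMonic.rmodpp // monic_mk_monic.
Qed.

Lemma in_qpoly_val h (p : {poly %/ h}) : in_qpoly h p = p.
Proof. exact/val_inj/in_qpoly_small/size_mk_monic. Qed.

(** The universal property of the quotient: a polynomial and its remainder differ by a multiple of
    the modulus, and substituting [q] sends that multiple to 0. The hypothesis speaks of
    [mk_monic h] because this is the polynomial by which [{poly %/ h}] really divides. *)
Lemma qpoly_substitution h g q :
    in_qpoly g (mk_monic h \Po q) = 0 ->
  exists phi : {lrmorphism {poly %/ h} -> {poly %/ g}},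
    forall f, phi (in_qpoly h f) = in_qpoly g (f \Po q).
Proof.
move=> hq0.
have hq_mod f : in_qpoly g (in_qpoly h f \Po q) = in_qpoly g (f \Po q).
  rewrite [in RHS](qpoly_divE h f) comp_polyD comp_polyM in_qpolyD in_qpolyM.
  by rewrite hq0 mulr0 add0r.
pose phi (p : {poly %/ h}) : {poly %/ g} := in_qpoly g (p \Po q).
have phiL : linear phi.
  by move=> c p r; rewrite /phi /= comp_polyD comp_polyZ in_qpolyD in_qpolyZ.
have phiM : monoid_morphism phi.
  split=> [|p r]; first by rewrite /phi comp_polyC in_qpoly1.
  (* A product in [{poly %/ h}] is a reduced product of representatives; [hq_mod] removes this
     reduction. *)
  by rewrite /phi hq_mod comp_polyM in_qpolyM.
have phiLM := GRing.isLinear.Build _ _ _ _ phi phiL.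
have phiMM := GRing.isMonoidMorphism.Build _ _ phi phiM.
pose phiLRM : {lrmorphism {poly %/ h} -> {poly %/ g}} :=
  HB.pack phi phiLM phiMM.
by exists phiLRM.
Qed.

End QuotientSubstitution.

Lemma comp_polyZX (R : comNzRingType) (f : {poly R}) (c d : R) :
  c * d = 1 -> (f \Po (c *: 'X)) \Po (d *: 'X) = f.
Proof.
by move=> cd1; rewrite -comp_polyA comp_polyZ comp_polyX scalerA cd1 scale1r
  comp_polyXr.
Qed.

Section Binomials.

Variable R : finComUnitRingType.
Implicit Types (alpha : R) (k n : nat) (a b : {poly R}).

Definition binomial_twist n k alpha a b :=
  b`_k * alpha ^+ (n - k) - a`_k = 0 /\ b`_0 * alpha ^+ n - a`_0 = 0.

Lemma binomial_twistV n k alpha a b :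
    alpha \is a GRing.unit ->
  binomial_twist n k alpha a b -> binomial_twist n k alpha^-1 b a.
Proof.
rewrite /binomial_twist => ua [/subr0_eq<- /subr0_eq<-].
by split; rewrite -mulrA -exprMn divrr // expr1n mulr1 subrr.
Qed.

Lemma B_coefE k b : (0 < k)%N -> B k b -> b = binom k b`_k b`_0.
Proof.
by move=> k0 [b1 [b0 [_ _ ->]]]; rewrite coef_binomk ?coef_binom0.
Qed.

Lemma B_coef_unit k b : (0 < k)%N -> B k b ->
  b`_k \is a GRing.unit /\ b`_0 \is a GRing.unit.
Proof.
by move=> k0 [b1 [b0 [ub1 ub0 ->]]]; rewrite coef_binomk ?coef_binom0.
Qed.

Lemma comp_binomZX k (b1 b0 c : R) :
  binom k b1 b0 \Po (c *: 'X) = binom k (b1 * c ^+ k) b0.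
Proof.
by rewrite /binom comp_polyD comp_polyZ comp_polyC comp_Xn_poly exprZn scalerA.
Qed.

Lemma size_binom k (b1 b0 : R) : (size (binom k b1 b0) <= k.+1)%N.
Proof.
rewrite (leq_trans (size_polyD _ _)) // geq_max.
rewrite (leq_trans (size_scale_leq _ _)) ?size_polyXn //=.
by rewrite (leq_trans (size_polyC_leq1 _)).
Qed.

Lemma size_subXn_B n k b : (k < n)%N -> B k b -> size ('X^n - b) = n.+1.
Proof.
move=> kn [b1 [b0 [_ _ ->]]]; rewrite size_polyDl size_polyXn //.
by rewrite size_polyN ltnS (leq_trans (size_binom _ _ _)).
Qed.

(** The terms in [b1] and [b0] cancel, so they are free. For [k < n] this is division with remainder
    by the monic ['X^n - binom k b1 b0]. *)
Lemma subXn_binomZX n k (a1 a0 b1 b0 c : R) :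
  ('X^n - binom k a1 a0) \Po (c *: 'X) =
  c ^+ n *: ('X^n - binom k b1 b0)
  + binom k (b1 * c ^+ n - a1 * c ^+ k) (b0 * c ^+ n - a0).
Proof.
rewrite comp_polyB comp_Xn_poly exprZn comp_binomZX /binom.
rewrite -!mul_polyC !polyCB !polyCM; ring.
Qed.

Lemma in_qpoly_substitution_eq0 n k alpha a b :
    (0 < k < n)%N -> B k a -> B k b -> alpha \is a GRing.unit ->
  in_qpoly ('X^n - b) (('X^n - a) \Po (alpha *: 'X)) = 0
  <-> binomial_twist n k alpha a b.
Proof.
move=> hkn ha hb ua; have /andP[k0 kn] := hkn.
pose c := binom k (b`_k * alpha ^+ n - a`_k * alpha ^+ k)
                  (b`_0 * alpha ^+ n - a`_0).
have -> : ('X^n - a) \Po (alpha *: 'X) = alpha ^+ n *: ('X^n - b) + c.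
  by rewrite [in LHS](B_coefE k0 ha) (subXn_binomZX _ _ _ _ b`_k b`_0) -B_coefE.
have hX : in_qpoly ('X^n - b) ('X^n - b) = 0.
  exact: in_qpoly_modulus (mk_monic_subXn hkn hb).
rewrite in_qpolyD in_qpolyZ hX scaler0 add0r.
(* As [c] has degree at most [k < n], it is its own remainder, so its class vanishes only if its
   coefficients do. *)
have cE : in_qpoly ('X^n - b) c = c :> {poly R}.
  rewrite in_qpoly_small // (mk_monic_subXn hkn hb).
  by rewrite (size_subXn_B kn hb) ltnS (leq_trans (size_binom _ _ _)).
(* Splitting off the unit [alpha ^+ k], which can be cancelled, leaves the first equation of the
   twist. *)
have twistE : b`_k * alpha ^+ n - a`_k * alpha ^+ k
              = (b`_k * alpha ^+ (n - k) - a`_k) * alpha ^+ k.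
  by rewrite mulrBl -mulrA -exprD subnK // ltnW.
split=> [/(congr1 val)/= | [ek e0]].
  rewrite [LHS]cE => c0; split.
    have /(congr1 (fun f : {poly R} => f`_k)) := c0.
    rewrite coef_binomk // coef0 twistE => ck0.
    by apply: (mulIr (unitrX k ua)); rewrite ck0 mul0r.
  have /(congr1 (fun f : {poly R} => f`_0)) := c0.
  by rewrite coef_binom0 // coef0.
by rewrite /c twistE ek e0 mul0r /binom scale0r addr0; apply: in_qpoly0.
Qed.

Lemma nequivP n k a b : (0 < k < n)%N -> B k a -> B k b ->
  nequiv n a b <->
  exists2 alpha, alpha \is a GRing.unit & binomial_twist n k alpha a b.
Proof.
move=> hkn ha hb.
have substP alpha c d : B k c -> B k d -> alpha \is a GRing.unit ->
    binomial_twist n k alpha c d ->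
  exists phi : {lrmorphism {poly %/ 'X^n - c} -> {poly %/ 'X^n - d}},
    forall f, phi (in_qpoly _ f) = in_qpoly _ (f \Po (alpha *: 'X)).
  move=> hc hd ua /(in_qpoly_substitution_eq0 hkn hc hd ua) cd0.
  by apply: qpoly_substitution; rewrite (mk_monic_subXn hkn hc).
split=> [[alpha ua [phi [_ phiE]]] | [alpha ua tw]]; exists alpha => //.
  (* The modulus ['X^n - a] is 0 in the source, so its image under [phi] is 0. *)
  apply/(in_qpoly_substitution_eq0 hkn ha hb ua); rewrite -phiE.
  by rewrite in_qpoly_modulus ?raddf0 // (mk_monic_subXn hkn ha).
have [phi phiE] := substP _ _ _ ha hb ua tw.
have uV : alpha^-1 \is a GRing.unit by rewrite unitrV.
have [psi psiE] := substP _ _ _ hb ha uV (binomial_twistV ua tw).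
exists phi; split=> //; exists psi => p.
  (* Writing [p] as the class of its representative lets the formulas for [phi] and [psi] apply; the
     scalings by [alpha] and its inverse then cancel. *)
  by rewrite -[p]in_qpoly_val phiE psiE comp_polyZX // divrr.
by rewrite -[p]in_qpoly_val psiE phiE comp_polyZX // mulVr.
Qed.

(** Both coefficients of [b] are units, so each twist equation can be solved for a power of [alpha]
    as a quotient of coefficients. The same [alpha] serves on both sides. *)
Lemma binomial_twist_starP n k alpha a b :
    (0 < k)%N -> B k b ->
  binomial_twist n k alpha a b <->
  star k a (star_inv k b) = binom k (alpha ^+ (n - k)) (alpha ^+ n).
Proof.
move=> k0 hb; have [ubk ub0] := B_coef_unit k0 hb.
rewrite /star /star_inv coef_binomk ?coef_binom0 //.
rewrite /binomial_twist.
split=> [[/subr0_eq<- /subr0_eq<-] | e].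
  by rewrite ![b`_ _ * _]mulrC !mulrK.
have /(congr1 (fun f : {poly R} => f`_k)) := e; rewrite !coef_binomk // => <-.
have /(congr1 (fun f : {poly R} => f`_0)) := e; rewrite !coef_binom0 // => <-.
by rewrite ![b`_ _ * _]mulrC !mulrVK // !subrr.
Qed.

End Binomials.

Theorem theorem4 (R : finComUnitRingType) (hR : finite_chain_ring R)
    (n k : nat) (hkn : (0 < k < n)%N) (a b : {poly R})
    (ha : B k a) (hb : B k b) :
  (nequiv n a b <->
   exists2 alpha : R, alpha \is a GRing.unit &
     b`_k * alpha ^+ (n - k) - a`_k = 0 /\ b`_0 * alpha ^+ n - a`_0 = 0) /\
  ((exists2 alpha : R, alpha \is a GRing.unit &
     b`_k * alpha ^+ (n - k) - a`_k = 0 /\ b`_0 * alpha ^+ n - a`_0 = 0) <->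
   H n k (star k a (star_inv k b))).
Proof.
split; first exact: nequivP.
have /andP[k0 _] := hkn.
by split=> -[alpha ua] /(binomial_twist_starP n alpha a k0 hb) ?; exists alpha.
Qed.
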